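(* Let $m\in\mathbb{N}$, let $G_1,\dots,G_m$ be compact Hausdorff topological groups, let $H_i$ be a closed translation invariant subspace of $C(G_i)$ for $i\in\{1,\dots,m\}$, let $F$ be a Banach space, $1\le p<\infty$, and let $u:H_1\times\dots\times H_m\to F$ be a translation $m$-invariant Lipschitz $p$-semi-integral operator. Then the normalized Haar measure $\sigma_G$ on $G=G_1\times\dots\times G_m$ is a Pietsch measure for $u$; that is, there is a constant $C>0$ such that for all $(T_1,\dots,T_m),(S_1,\dots,S_m)\in H_1\times\dots\times H_m$, $$\|u(T_1,\dots,T_m)-u(S_1,\dots,S_m)\|_F\le C\left(\int_{G}|T_1(\varphi_1)\cdots T_m(\varphi_m)-S_1(\varphi_1)\cdots S_m(\varphi_m)|^p\,d\sigma_G(\varphi)\right)^{1/p},$$ where $\varphi=(\varphi_1,\dots,\varphi_m)$.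
   Context: All Banach spaces are over the same scalar field $\mathbb{K}=\mathbb{R}$ or $\mathbb{C}$; $C(K)$ is the Banach space of continuous functions $K\to\mathbb{K}$ with the sup norm; $B_{E^*}$ is the closed unit ball of the dual of $E$. The group $G=G_1\times\dots\times G_m$ carries the coordinatewise operation and the product topology. The normalized Haar measure $\sigma_G$ is the unique Radon measure on $G$ with $\sigma_G(G)=1$ and $\sigma_G(\psi B)=\sigma_G(B)$ for every $\psi\in G$ and every Borel set $B\subseteq G$. For $\psi_i\in G_i$, $I_{\psi_i}:G_i\to G_i$ is $I_{\psi_i}(\varphi_i)=\psi_i\varphi_i$. A nonempty subset $H_i\subseteq C(G_i)$ is translation invariant if $T\circ I_{\psi_i}\in H_i$ for all $T\in H_i$, $\psi_i\in G_i$. A map $u$ on $H_1\times\dots\times H_m$ is translation $m$-invariant if $u(T_1\circ I_{\psi_1},\dots,T_m\circ I_{\psi_m})=u(T_1,\dots,T_m)$ for all $(T_1,\dots,T_m)\in H_1\times\dots\times H_m$ and all $(\psi_1,\dots,\psi_m)\in G_1\times\dots\times G_m$. For Banach spaces $E_1,\dots,E_m,F$, a continuous $m$-linear operator $u:E_1\times\dots\times E_m\to F$ is Lipschitz $p$-semi-integral if there is a constant $C>0$ such that for all $n\in\mathbb{N}$ and all $(x_{1,j},\dots,x_{m,j}),(q_{1,j},\dots,q_{m,j})\in E_1\times\dots\times E_m$, $j\in\{1,\dots,n\}$, $$\left(\sum_{j=1}^n\|u(x_{1,j},\dots,x_{m,j})-u(q_{1,j},\dots,q_{m,j})\|_F^p\right)^{1/p}\le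 C\sup_{(\alpha_1,\dots,\alpha_m)\in B_{E_1^*}\times\dots\times B_{E_m^*}}\left(\sum_{j=1}^n|\alpha_1(x_{1,j})\cdots\alpha_m(x_{m,j})-\alpha_1(q_{1,j})\cdots\alpha_m(q_{m,j})|^p\right)^{1/p}.$$ A regular Borel probability measure $\nu$ on $G_1\times\dots\times G_m$ is called a Pietsch measure for such a $u$ if the integral inequality displayed in the claim holds with $\nu$ in place of $\sigma_G$, for some constant $C>0$ and all $(T_i),(S_i)$. *)

(* Defs.v *)
From HB Require Import structures.
Set Warnings "-notation-overridden,-redundant-canonical-projection,-notation-incompatible-prefix".
From mathcomp Require Import all_boot all_order all_algebra.
From mathcomp Require Import complex.
From mathcomp Require Import all_classical all_reals all_analysis.

Set Implicit Arguments.
Unset Strict Implicit.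
Unset Printing Implicit Defensive.

Import Order.TTheory GRing.Theory Num.Theory.
Import numFieldNormedType.Exports.

Local Open Scope classical_set_scope.
Local Open Scope ring_scope.

Variant scalar_kind := RealScalars | ComplexScalars.

Definition scalars (R : realType) (k : scalar_kind) : numFieldType :=
  match k with
  | RealScalars => R : numFieldType
  | ComplexScalars => R[i] : numFieldType
  end.

(* Norms take their values in the scalar field, where they are nonnegative and
   hence real; scalarRe and realScalar pass between that copy of the reals and
   R itself. *)
Definition scalarRe (R : realType) (k : scalar_kind) : scalars R k -> R :=
  match k return scalars R k -> R with
  | RealScalars => fun x => x
  | ComplexScalars => fun z => complex.Re z
  end.

Definition realScalar (R : realType) (k : scalar_kind) : R -> scalars R k :=
  match k return R -> scalars R k with
  | RealScalars => fun x => x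
  | ComplexScalars => fun x => Complex x 0
  end.

Section Scalars.
Context {R : realType} {k : scalar_kind}.
Local Notation K := (scalars R k).
Implicit Types (x y : R) (z w : K).

Lemma realScalarK x : scalarRe (realScalar k x) = x.
Proof. by rewrite /scalarRe /realScalar; case: k. Qed.

Lemma scalarReD z w : scalarRe (z + w) = scalarRe z + scalarRe w.
Proof.
move: z w; rewrite /scalars /scalarRe; case: k => //= z w.
by case: z => [a b]; case: w => [c d].
Qed.

Lemma scalarRe_le z w : z <= w -> scalarRe z <= scalarRe w.
Proof.
move: z w; rewrite /scalars /scalarRe; case: k => //= z w.
by rewrite lecE => /andP[].
Qed.

Lemma realScalar_le x y : (realScalar k x <= realScalar k y) = (x <= y).
Proof.
rewrite /scalars /realScalar; case: k => //=.
by rewrite lecE /= eqxx.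
Qed.

Lemma realScalarD x y : realScalar k (x + y) = realScalar k x + realScalar k y.
Proof.
rewrite /scalars /realScalar; case: k => //=.
by apply/eqP; rewrite eq_complex /= addr0 !eqxx.
Qed.

Lemma realScalarM x y : realScalar k (x * y) = realScalar k x * realScalar k y.
Proof.
rewrite /scalars /realScalar; case: k => //=.
by apply/eqP; rewrite eq_complex /= !(mulr0, mul0r, subr0, addr0) !eqxx.
Qed.

Lemma realScalar0 : realScalar k 0 = 0 :> K.
Proof. by apply: (addrI (realScalar k 0)); rewrite -realScalarD !addr0. Qed.

Lemma scalarReK z : 0 <= z -> realScalar k (scalarRe z) = z.
Proof.
move: z; rewrite /scalars /scalarRe /realScalar; case: k => //= -[a b].
by rewrite lecE /= => /andP[/eqP -> _].
Qed.

End Scalars.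

Definition rnorm {R : realType} {k : scalar_kind}
    {V : normedModType (scalars R k)} (x : V) : R :=
  scalarRe `|x|.

Section RealNorm.
Context {R : realType} {k : scalar_kind} {V : normedModType (scalars R k)}.
Implicit Types x y : V.

Lemma rnormK x : realScalar k (rnorm x) = `|x|.
Proof. exact: scalarReK. Qed.

Lemma rnorm_ge0 x : 0 <= rnorm x.
Proof. by rewrite -(realScalar_le (k := k)) rnormK realScalar0. Qed.

Lemma rnorm0_eq0 x : rnorm x = 0 -> x = 0.
Proof. by move=> x0; apply/normr0_eq0; rewrite -rnormK x0 realScalar0. Qed.

Lemma rnormD x y : rnorm (x + y) <= rnorm x + rnorm y.
Proof. by rewrite -scalarReD; apply/scalarRe_le/ler_normD. Qed.

Lemma rnormN x : rnorm (- x) = rnorm x.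
Proof. by rewrite /rnorm normrN. Qed.

Lemma rnormZ (l : scalars R k) x : rnorm (l *: x) = scalarRe `|l| * rnorm x.
Proof.
apply: (can_inj (@realScalarK R k)).
by rewrite realScalarM !rnormK normrZ scalarReK.
Qed.

Lemma rnorm_continuous : continuous (@rnorm R k V).
Proof.
move=> x; apply/cvgrPdist_le => e e0.
have e0K : 0 < realScalar k e.
  rewrite lt_neqAle -[leLHS](realScalar0 (R := R)) realScalar_le ltW// andbT.
  rewrite -(realScalar0 (R := R)) (can_eq (@realScalarK R k)).
  by rewrite eq_sym gt_eqF.
have /cvgrPdist_le/(_ _ e0K) : y @[y --> x] --> x by exact: cvg_id.
apply: filterS => y; rewrite -rnormK realScalar_le => xye.
rewrite ler_norml lerBlDr lerNl opprB lerBlDr; apply/andP; split.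
  rewrite -{1}(subrK x y) (le_trans (rnormD _ _))// lerD2r.
  by rewrite -rnormN opprB.
by rewrite -{1}(subrK y x) (le_trans (rnormD _ _))// lerD2r.
Qed.

End RealNorm.

HB.mixin Record isCompactHausdorff T & Topological T := {
  compact_setT : compact [set: T];
  hausdorff_setT : hausdorff_space T
}.

#[short(type="compactHausdorffType")]
HB.structure Definition CompactHausdorff :=
  {T of Topological T & isCompactHausdorff T}.

HB.mixin Record isTopologicalGroup G & Topological G & Group G := {
  mulg_continuous : continuous (fun x : G * G => (x.1 * x.2)%g);
  invg_continuous : continuous (fun x : G => x^-1%g)
}.

#[short(type="compactGroupType")]
HB.structure Definition CompactGroup :=
  {G of CompactHausdorff G & Group G & isTopologicalGroup G}.

Definition prod_group (I : eqType) (G : I -> compactGroupType) : Type :=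
  forall i, G i.

Section ProductGroup.
Variables (I : eqType) (G : I -> compactGroupType).
Local Notation PG := (prod_group G).

HB.instance Definition _ := Topological.copy PG (prod_topology G).

Let pmul (x y : PG) : PG := fun i => (x i * y i)%g.
Let pone : PG := fun i => 1%g.
Let pinv (x : PG) : PG := fun i => (x i)^-1%g.

Let pmulA : associative pmul.
Proof. by move=> x y z; apply/functional_extensionality_dep => i; exact: mulgA. Qed.
Let pmul1 : left_id pone pmul.
Proof. by move=> x; apply/functional_extensionality_dep => i; exact: mul1g. Qed.
Let pmulr1 : right_id pone pmul.
Proof. by move=> x; apply/functional_extensionality_dep => i; exact: mulg1. Qed.
Let pmulV : left_inverse pone pinv pmul.
Proof. by move=> x; apply/functional_extensionality_dep => i; exact: mulVg. Qed.
Let pmulrV : right_inverse pone pinv pmul.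
Proof. by move=> x; apply/functional_extensionality_dep => i; exact: mulgV. Qed.

HB.instance Definition _ := isGroup.Build PG pmulA pmul1 pmulr1 pmulV pmulrV.

Let pcompact : compact [set: PG].
Proof.
have -> : [set: PG] = [set f : prod_topology G | forall i, [set: G i] (f i)].
  by apply/seteqP; split.
by apply: (@tychonoff I G (fun=> setT)) => i; exact: compact_setT.
Qed.

Let phausdorff : hausdorff_space PG.
Proof. by apply: hausdorff_product => i; exact: hausdorff_setT. Qed.

HB.instance Definition _ := isCompactHausdorff.Build PG pcompact phausdorff.

Let coord_continuous i : continuous (fun x : PG => x i).
Proof. exact: (@proj_continuous _ G i). Qed.

Let continuous_coord (T : topologicalType) (f : T -> PG) :
  (forall i, continuous (fun t => f t i)) -> continuous f.
Proof.
move=> fc t; apply/cvg_sup => i U [V] [[W] oW <-] Wft WU.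
apply: (filterS WU); apply: (fc i t).
exact: open_nbhs_nbhs.
Qed.

Let pmul_continuous : continuous (fun x : PG * PG => (x.1 * x.2)%g).
Proof.
apply: continuous_coord => i x.
apply: (@continuous_comp _ _ _ (fun x : PG * PG => (x.1 i, x.2 i))
  (fun y : G i * G i => (y.1 * y.2)%g)); last exact: mulg_continuous.
apply: cvg_pair.
- apply: (@continuous_comp _ _ _ (fun x : PG * PG => x.1) (fun y : PG => y i)).
    exact: cvg_fst.
  exact: coord_continuous.
- apply: (@continuous_comp _ _ _ (fun x : PG * PG => x.2) (fun y : PG => y i)).
    exact: cvg_snd.
  exact: coord_continuous.
Qed.

Let pinv_continuous : continuous (fun x : PG => x^-1%g).
Proof.
apply: continuous_coord => i x.
apply: (@continuous_comp _ _ _ (fun x : PG => x i) (fun y : G i => y^-1%g)).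
  exact: coord_continuous.
exact: invg_continuous.
Qed.

HB.instance Definition _ :=
  isTopologicalGroup.Build PG pmul_continuous pinv_continuous.

End ProductGroup.

(* C(X), normed by sup_norm. *)
Definition cspace (R : realType) (k : scalar_kind) (X : compactHausdorffType) :
  Type := continuousType X (scalars R k)^o.

Section ContinuousFunctions.
Variables (R : realType) (k : scalar_kind) (X : compactHausdorffType).
Local Notation K := (scalars R k).
Local Notation C := (cspace R k X).

Definition continuous_pred : {pred X -> K^o} :=
  fun f => `[< continuous f >].

Lemma continuous_predP f : reflect (continuous f) (f \in continuous_pred).
Proof. exact: asboolP. Qed.

Let cfun_sub (f : X -> K^o) (fP : f \in continuous_pred) : C :=
  mkcts (elimT (continuous_predP f) fP).

Let cfun_rect (P : C -> Type) :
  (forall f (fP : f \in continuous_pred), P (cfun_sub fP)) -> forall u, P u.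
Proof.
move=> Psub u.
have uP : (u : X -> K^o) \in continuous_pred.
  by apply/continuous_predP; exact: cts_fun.
suff -> : u = cfun_sub uP by exact: Psub.
exact/continuousEP.
Qed.

Let cfun_valP f (fP : f \in continuous_pred) : cfun_sub fP = f :> (X -> K^o).
Proof. by []. Qed.

HB.instance Definition _ := Choice.on C.
HB.instance Definition _ :=
  @isSub.Build (X -> K^o) continuous_pred C (fun f : C => (f : X -> K^o))
    cfun_sub cfun_rect cfun_valP.

Let continuous_submod_closed : submod_closed continuous_pred.
Proof.
split; first by apply/continuous_predP => x; exact: cvg_cst.
move=> a f g /continuous_predP fc /continuous_predP gc.
apply/continuous_predP => x; apply: cvgD; last exact: gc.
by apply: cvgZr; exact: fc.
Qed.

HB.instance Definition _ :=
  GRing.isSubmodClosed.Build _ _ continuous_pred continuous_submod_closed.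
HB.instance Definition _ := [SubChoice_isSubLmodule of C by <:].

Definition sup_norm (f : C) : R := sup (range (fun x => rnorm (f x))).

Let norm_has_sup (f : C) (x : X) : has_sup (range (fun y => rnorm (f y))).
Proof.
apply: compact_has_sup; first by exists (rnorm (f x)), x.
apply: continuous_compact; last exact: compact_setT.
apply: continuous_subspaceT => y.
apply: (@continuous_comp _ _ _ f (@rnorm R k K^o)); first exact: cts_fun.
exact: rnorm_continuous.
Qed.

Lemma rnorm_le_sup_norm (f : C) x : rnorm (f x) <= sup_norm f.
Proof. by apply: ub_le_sup; [exact: (norm_has_sup f x).2 | exists x]. Qed.

Lemma sup_norm_le (f : C) (M : R) :
  0 <= M -> (forall x, rnorm (f x) <= M) -> sup_norm f <= M.
Proof.
move=> M0 fM; rewrite /sup_norm.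
have [->|/set0P[y]] := eqVneq (range (fun x => rnorm (f x))) set0.
  by rewrite sup0.
by move=> yf; apply: ge_sup; [exists y | move=> _ [x _ <-]].
Qed.

Lemma sup_norm_ge0 (f : C) : 0 <= sup_norm f.
Proof.
rewrite /sup_norm.
have [->|/set0P[_ [x _ _]]] := eqVneq (range (fun x => rnorm (f x))) set0.
  by rewrite sup0.
exact: le_trans (rnorm_ge0 _) (rnorm_le_sup_norm f x).
Qed.

Let norm (f : C) : K := realScalar k (sup_norm f).

Let normD (f g : C) : norm (f + g) <= norm f + norm g.
Proof.
rewrite -realScalarD realScalar_le; apply: sup_norm_le => [|x].
  by rewrite addr_ge0 ?sup_norm_ge0.
by apply: le_trans (rnormD _ _) _; rewrite lerD ?rnorm_le_sup_norm.
Qed.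

Let norm0_eq0 (f : C) : norm f = 0 -> f = 0.
Proof.
rewrite -(realScalar0 (R := R)) => /(can_inj (@realScalarK R k)) f0.
apply/continuousEP => x; apply: rnorm0_eq0; apply/eqP.
by rewrite eq_le rnorm_ge0 andbT -f0 rnorm_le_sup_norm.
Qed.

Let le_normZ (l : K) (f : C) : norm (l *: f) <= `|l| * norm f.
Proof.
have l0 : 0 <= scalarRe `|l| by exact: (@rnorm_ge0 R k K^o l).
rewrite -[`|l|]scalarReK// -realScalarM realScalar_le.
apply: sup_norm_le => [|x]; first by rewrite mulr_ge0 ?sup_norm_ge0.
rewrite -[X in rnorm X]/(l *: (f x : K^o)) rnormZ.
by rewrite ler_wpM2l ?rnorm_le_sup_norm.
Qed.

Let normZ (l : K) (f : C) : norm (l *: f) = `|l| * norm f.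
Proof.
apply/eqP; rewrite eq_le le_normZ/=.
have [->|l0] := eqVneq l 0.
  rewrite normr0 mul0r /norm -(realScalar0 (R := R)) realScalar_le.
  exact: sup_norm_ge0.
have := le_normZ l^-1 (l *: f); rewrite scalerA mulVf// scale1r normfV.
by rewrite ler_pdivlMl// normr_gt0.
Qed.

HB.instance Definition _ := Lmodule_isNormed.Build K C normD normZ norm0_eq0.

End ContinuousFunctions.

(* A linear subspace, seen as a normed space with the restricted norm; when the
   ambient space is complete and the subspace closed, it is a Banach space. *)
Record subspace_of (K : numFieldType) (V : normedModType K)
    (S : submodClosed V) : Type :=
  Subspace { subspace_val : V; subspace_valP : subspace_val \in S }.

Section Subspace.
Variables (K : numFieldType) (V : normedModType K) (S : submodClosed V).
Local Notation W := (subspace_of S).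

HB.instance Definition _ := [isSub for @subspace_val K V S].
HB.instance Definition _ := [Choice of W by <:].
HB.instance Definition _ := [SubChoice_isSubLmodule of W by <:].

Let norm (w : W) : K := `|val w|.

Let normD (v w : W) : norm (v + w) <= norm v + norm w.
Proof. exact: ler_normD. Qed.
Let normZ (l : K) (w : W) : norm (l *: w) = `|l| * norm w.
Proof. exact: normrZ. Qed.
Let norm0_eq0 (w : W) : norm w = 0 -> w = 0.
Proof. by move=> /normr0_eq0 w0; exact: val_inj. Qed.

HB.instance Definition _ := Lmodule_isNormed.Build K W normD normZ norm0_eq0.

End Subspace.

Section Operators.
Variables (R : realType) (k : scalar_kind).
Local Notation K := (scalars R k).

Definition dual_ball (E : normedModType K) : set {scalar E} :=
  [set alpha | continuous (alpha : E -> K) /\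
    forall x : E, `|x| <= 1 -> `|alpha x| <= 1].

(* Completeness of the E i and of F plays no role in the next definitions. *)
Variables (m : nat) (E : 'I_m -> normedModType K) (F : normedModType K).
Implicit Type u : (forall i, E i) -> F.

Definition multilinear u : Prop :=
  forall (T : forall i, E i) (i : 'I_m), linear (fun x : E i => u (dfwith T i x)).

Definition lipschitz_semi_integral (p : R) u : Prop :=
  [/\ multilinear u,
      continuous (u : prod_topology E -> F) &
      exists2 C : R, 0 < C &
        forall (n : nat) (x q : 'I_n -> forall i, E i),
          (((\sum_(j < n) rnorm (u (x j) - u (q j)) `^ p) `^ p^-1)%:E <=
           C%:E * ereal_sup
             [set ((\sum_(j < n)
                 scalarRe `|\prod_(i < m) alpha i (x j i)
                            - \prod_(i < m) alpha i (q j i)| `^ p)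
                `^ p^-1)%:E
             | alpha in [set alpha : forall i, {scalar E i} |
                          forall i, dual_ball (alpha i)]])%E].

End Operators.

Section Translations.
Variables (R : realType) (k : scalar_kind).

Lemma translate_continuous (G : compactGroupType) (psi : G) (T : cspace R k G) :
  continuous (fun phi : G => T (psi * phi)%g).
Proof.
move=> phi.
apply: (@continuous_comp _ _ _ (fun phi : G => (psi * phi)%g) T); last first.
  exact: cts_fun.
apply: (@continuous_comp _ _ _ (fun phi : G => (psi, phi))
  (fun y : G * G => (y.1 * y.2)%g)); last exact: mulg_continuous.
by apply: cvg_pair; [exact: cvg_cst | exact: cvg_id].
Qed.

Definition translate (G : compactGroupType) (psi : G) (T : cspace R k G) :
  cspace R k G := mkcts (@translate_continuous G psi T).

Definition translation_invariant (G : compactGroupType)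
    (H : {pred cspace R k G}) : Prop :=
  forall (psi : G) (T : cspace R k G), T \in H -> translate psi T \in H.

Definition subspace_translate (G : compactGroupType)
    (H : submodClosed (cspace R k G)) (H_inv : translation_invariant H)
    (psi : G) (T : subspace_of H) : subspace_of H :=
  Subspace (H_inv psi (val T) (subspace_valP T)).

Definition translation_multi_invariant (m : nat) (G : 'I_m -> compactGroupType)
    (H : forall i, submodClosed (cspace R k (G i)))
    (H_inv : forall i, translation_invariant (H i))
    (F : Type) (u : (forall i, subspace_of (H i)) -> F) : Prop :=
  forall (T : forall i, subspace_of (H i)) (psi : forall i, G i),
    u (fun i => subspace_translate (H_inv i) (psi i) (T i)) = u T.

End Translations.

(* On prod_group G this is the Borel sigma-algebra of the product topology,
   which may be larger than the product of the Borel sigma-algebras. *)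
Definition borel (G : compactGroupType) : Type := G.

Section Borel.
Variable G : compactGroupType.

HB.instance Definition _ := Choice.on (borel G).
HB.instance Definition _ := isPointed.Build (borel G) (1%g : G).
HB.instance Definition _ := @isMeasurable.Build (sigma_display (@open G))
  (borel G) <<s @open G >> (@sigma_algebra0 _ setT _)
  (@sigma_algebraC (borel G) _) (@sigma_algebra_bigcup _ setT _).

End Borel.

Section Measures.
Variables (R : realType) (G : compactGroupType).
Implicit Type mu : probability (borel G) R.

(* For a Borel probability on a compact Hausdorff space this is the same as
   being a Radon measure. *)
Definition regular mu : Prop :=
  forall B : set (borel G), measurable B ->
    mu B = ereal_sup [set mu C | C in
             [set C : set G | compact C /\ C `<=` B]] /\
    mu B = ereal_inf [set mu U | U in [set U : set G | open U /\ B `<=` U]].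

Definition normalized_haar mu : Prop :=
  regular mu /\
  forall (psi : G) (B : set G), measurable (B : set (borel G)) ->
    mu [set (psi * phi)%g | phi in B] = mu B.

End Measures.

Definition pietsch_measure (R : realType) (k : scalar_kind) (m : nat)
    (G : 'I_m -> compactGroupType)
    (H : forall i, submodClosed (cspace R k (G i)))
    (F : normedModType (scalars R k)) (p : R)
    (u : (forall i, subspace_of (H i)) -> F)
    (nu : probability (borel (prod_group G)) R) : Prop :=
  regular nu /\
  exists2 C : R, 0 < C &
    forall T S : forall i, subspace_of (H i),
      ((rnorm (u T - u S))%:E <=
       C%:E * (\int[nu]_phi
         (scalarRe `|\prod_(i < m) val (T i) (phi i)
                     - \prod_(i < m) val (S i) (phi i)|
            `^ p)%:E) `^ p^-1)%E.

(* Main.v *)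
From HB Require Import structures.
Require Import Defs.
From mathcomp Require Import all_boot all_order all_algebra.
From mathcomp Require Import finmap lra.
From mathcomp Require Import all_classical all_reals all_analysis.
From mathcomp Require Import measurable_realfun.

Set Implicit Arguments.
Unset Strict Implicit.
Unset Printing Implicit Defensive.

Import Order.TTheory GRing.Theory Num.Theory.
Import numFieldNormedType.Exports.

Local Open Scope classical_set_scope.
Local Open Scope ring_scope.

(* Write f = |T_1 ... T_m - S_1 ... S_m|^p.  The supremum over the dual balls in
   the semi-integral inequality may be taken over point evaluations only: with
   all functionals but one frozen, the j-th term is |alpha(g_j)|^p for some g_j
   in H_i, and duality in l^p bounds the sum of these by
   sup_phi sum_j |g_j(phi)|^p.  Apply the inequality to the translates of T and
   S by psi_1, ..., psi_n: by invariance every term on the left equals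
   |u(T) - u(S)|^p, so
     n |u(T) - u(S)|^p <= C sup_phi sum_j f(psi_j phi).
   Convex combinations of translates of f come uniformly close to the Haar
   integral of f, which gives the claim without Hahn-Banach or a minimax
   theorem. *)

(** * Continuity, measurability and translation on a compact group *)

Lemma continuous_borel_measurable (R : realType) (G : compactGroupType)
    (f : G -> R) :
  continuous f -> measurable_fun [set: borel G] (f : borel G -> R).
Proof.
move=> /continuousP cf mD.
apply: (measurability _ (RGenOpens.measurableE R)) => //.
move=> _ [_ [a [b ->] <-]]; rewrite setTI; apply: sub_sigma_algebra.
exact/cf/interval_open.
Qed.

Lemma continuous_mulg_inv (G : compactGroupType) :
  continuous (fun x : G * G => (x.1^-1 * x.2)%g).
Proof.
move=> x.
apply: (@continuous_comp _ _ _ (fun x : G * G => (x.1^-1, x.2)%g)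
  (fun y : G * G => (y.1 * y.2)%g)); last exact: mulg_continuous.
apply: cvg_pair; last exact: cvg_snd.
apply: (@continuous_comp _ _ _ fst (fun y : G => y^-1%g)); first exact: cvg_fst.
exact: invg_continuous.
Qed.

Lemma mulg_continuousr (G : compactGroupType) (psi : G) :
  continuous (fun phi : G => (psi * phi)%g).
Proof.
move=> phi; apply: (@continuous_comp _ _ _ (fun phi : G => (psi, phi))
  (fun y : G * G => (y.1 * y.2)%g)); last exact: mulg_continuous.
by apply: cvg_pair; [exact: cvg_cst | exact: cvg_id].
Qed.

(** The difference is jointly continuous in [phi] and [psi] and vanishes at [psi = psi0];
    compactness of [G], in near-covering form, makes the neighbourhood of [psi0] independent of
    [phi]. *)
Lemma translate_near_uniform (R : realType) (G : compactGroupType)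
    (f : G -> R) (e : R) (psi0 : G) :
  continuous f -> 0 < e ->
  \forall psi \near psi0, forall phi,
    `|f (psi^-1 * phi)%g - f (psi0^-1 * phi)%g| < e.
Proof.
move=> cf e0.
have near_setT : near_covering [set: G].
  by rewrite -compact_near_coveringP; exact: compact_setT.
suff : \forall psi \near psi0,
    [set: G] `<=` [set phi | `|f (psi^-1 * phi)%g - f (psi0^-1 * phi)%g| < e].
  by apply: filterS => psi Hpsi phi; exact: Hpsi.
apply: (near_setT G (nbhs psi0) (fun psi phi =>
  `|f (psi^-1 * phi)%g - f (psi0^-1 * phi)%g| < e)) => phi _.
have h : continuous (fun x : G * G =>
    f (x.2^-1 * x.1)%g - f (psi0^-1 * x.1)%g).
  move=> x; apply: cvgB.
    apply: (@continuous_comp _ _ _ (fun x : G * G => (x.2^-1 * x.1)%g) f).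
      apply: (@continuous_comp _ _ _ (fun x : G * G => (x.2, x.1))
        (fun y : G * G => (y.1^-1 * y.2)%g)); last exact: continuous_mulg_inv.
      by apply: cvg_pair; [exact: cvg_snd | exact: cvg_fst].
    exact: cf.
  apply: (@continuous_comp _ _ _ (fun x : G * G => (psi0^-1 * x.1)%g) f).
    apply: (@continuous_comp _ _ _ fst (fun y : G => (psi0^-1 * y)%g)).
      exact: cvg_fst.
    exact: mulg_continuousr.
  exact: cf.
have := h (phi, psi0); rewrite /= => /cvgrPdist_lt/(_ _ e0).
rewrite subrr; apply: filterS => -[x y] /=.
by rewrite sub0r normrN.
Qed.

(** The left side is the integral of [f] against the pushforward of [sigma] by left multiplication.
    The preimage of [A] under it is the image of [A] under multiplication by [psi^-1], so invariance
    identifies the two measures. *)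
Lemma haar_integral_translate (R : realType) (G : compactGroupType)
    (sigma : probability (borel G) R) (psi : G) (f : borel G -> \bar R) :
  normalized_haar sigma ->
  measurable_fun [set: borel G] (f : borel G -> \bar R) ->
  (forall x, 0 <= f x)%E ->
  (\int[sigma]_phi f (psi * phi)%g = \int[sigma]_phi f phi)%E.
Proof.
move=> [_ sinv] mf f0.
pose t : borel G -> borel G := fun phi : G => (psi * phi)%g.
have mt : measurable_fun [set: borel G] (t : borel G -> borel G).
  move=> mD; apply: (@measurability _ _ _ _ setT t (@open G)) => //.
  move=> _ [U oU <-]; rewrite setTI; apply: sub_sigma_algebra.
  by move: U oU; apply/continuousP; exact: mulg_continuousr.
transitivity (\int[pushforward sigma t]_(y in setT) f y)%E.
  by rewrite ge0_integral_pushforward.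
apply: eq_measure_integral => A mA _.
rewrite -[RHS](sinv psi^-1%g A mA).
congr (sigma _); apply/seteqP; split => [x Ax|_ [y Ay <-]] /=.
  by exists (psi * x)%g => //; rewrite mulgA mulVg mul1g.
by rewrite /t mulgA mulgV mul1g.
Qed.

(** * Comparison of an integral with sums over a finite partition *)

Section Partition.
Variables (d : measure_display) (T : measurableType d) (R : realType).
Variables (mu : {measure set T -> \bar R}) (n : nat) (B : nat -> set T).
Hypotheses (mB : forall i, measurable (B i)) (tB : trivIset setT B)
  (cB : \big[setU/set0]_(0 <= i < n) B i = setT).

Let integral_partition (g : T -> \bar R) :
  measurable_fun setT g -> (forall x, 0 <= g x)%E ->
  (\int[mu]_x g x = \sum_(0 <= i < n) \int[mu]_(x in B i) g x)%E.
Proof.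
move=> mg g0; rewrite -cB ge0_integral_bigsetU//; first exact: iota_uniq.
  by apply: sub_trivIset tB.
by rewrite cB.
Qed.

Lemma integral_le_partition (g : T -> \bar R) (a : nat -> \bar R) :
  measurable_fun setT g -> (forall x, 0 <= g x)%E ->
  (forall i x, B i x -> g x <= a i)%E ->
  (\int[mu]_x g x <= \sum_(0 <= i < n) a i * mu (B i))%E.
Proof.
move=> mg g0 ga; rewrite integral_partition//; apply: lee_sum => i _.
rewrite -integral_cst//; apply: ge0_le_integral => //.
  exact: measurable_funTS.
exact: ga.
Qed.

Lemma integral_ge_partition (g : T -> \bar R) (a : nat -> \bar R) :
  measurable_fun setT g -> (forall i, 0 <= a i)%E ->
  (forall i x, B i x -> a i <= g x)%E ->
  (\sum_(0 <= i < n) a i * mu (B i) <= \int[mu]_x g x)%E.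
Proof.
move=> mg a0 ag; rewrite integral_partition//; last first.
  (* Nonnegativity of [g] comes from that of the [a i], because the [B i] cover the space. *)
  move=> x; have : [set: T] x by [].
  rewrite -cB -bigcup_seq => -[i _ Bx].
  exact: le_trans (a0 i) (ag _ _ Bx).
apply: lee_sum => i _.
rewrite -integral_cst//; apply: ge0_le_integral => //.
- by move=> x _; exact: a0.
- exact: measurable_funTS.
- exact: ag.
Qed.

End Partition.

(** * Approximation of the Haar integral by averages of translates *)

(** Open sets of [chi] on which [f (chi^-1 * phi)] barely varies, uniformly in [phi], cover [G]; a
    finite subcover is made disjoint by [seqDU]. *)
Lemma translate_partition (R : realType) (G : compactGroupType)
    (f : G -> R) (e : R) :
  continuous f -> 0 < e ->
  exists (n : nat) (B : nat -> set (borel G)) (psi : nat -> G),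
  [/\ forall i, measurable (B i), trivIset setT B,
     \big[setU/set0]_(0 <= i < n) B i = setT &
     forall i (chi phi : G), B i chi ->
       `|f (chi^-1 * phi)%g - f ((psi i)^-1 * phi)%g| < e].
Proof.
move=> cf e0.
have /choice[W HW] (psi : G) : exists W : set G, open_nbhs psi W /\
    forall chi, W chi -> forall phi,
      `|f (chi^-1 * phi)%g - f (psi^-1 * phi)%g| < e.
  have : nbhs psi [set chi | forall phi,
      `|f (chi^-1 * phi)%g - f (psi^-1 * phi)%g| < e].
    exact: translate_near_uniform.
  by rewrite nbhsE => -[W oW WP]; exists W.
pose G' : ptopologicalType :=
  HB.pack (CompactGroup.sort G) (isPointed.Build G 1%g).
have : @cover_compact G [set: G].
  have : @compact G' setT by exact: compact_setT.
  by rewrite compact_cover.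
move=> /(_ G setT W (fun psi _ => (HW psi).1.1))[|D _ DW].
  by move=> psi _; exists psi => //; exact: (HW psi).1.2.
(* Past the end of [s], [psi i] defaults to the unit; measurability and the estimate still hold
   there, since every point has its own [W]. *)
pose s := enum_fset D; pose psi i := nth 1%g s i.
exists (size s), (seqDU (W \o psi)), psi; split.
- move=> i; apply: seqDU_measurable => j; apply: sub_sigma_algebra.
  exact: (HW _).1.1.
- exact: trivIset_seqDU.
- rewrite big_mkord -bigsetU_seqDU -subTset => x /DW[chi /= Dchi Wx].
  rewrite -(big_mkord xpredT (W \o psi)) -bigcup_seq.
  exists (index chi s) => /=.
    by rewrite mem_index_iota /= index_mem.
  by rewrite /psi nth_index.
- by move=> i chi phi [Wchi _]; exact: (HW _).2.
Qed.

(** For each [phi] the average is a Riemann sum of [chi |-> f (chi^-1 * phi)] over the partition,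
    with weights [sigma (B i)] and an error bound independent of [phi]. Half of [e] pays for
    comparing the sum with the integral [c] below, half for comparing [c] with the integral of
    [f]. *)
Lemma haar_average (R : realType) (G : compactGroupType)
    (sigma : probability (borel G) R) (f : G -> R) (e : R) :
  normalized_haar sigma -> continuous f -> (forall x, 0 <= f x) -> 0 < e ->
  exists (n : nat) (w : nat -> R) (psi : nat -> G),
    [/\ forall i, 0 <= w i, \sum_(0 <= i < n) w i = 1 &
    forall phi, ((\sum_(0 <= i < n) w i * f (psi i * phi)%g)%:E <=
       \int[sigma]_phi (f phi)%:E + e%:E)%E].
Proof.
move=> hs cf f0 e0.
have e20 : 0 < e / 2 by rewrite divr_gt0.
have [n [B [psi [mB tB cB fB]]]] := translate_partition cf e20.
exists n, (fun i => fine (sigma (B i))), (fun i => (psi i)^-1%g).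
have sB i : sigma (B i) = (fine (sigma (B i)))%:E.
  by rewrite fineK// fin_num_measure.
have s1 : \sum_(0 <= i < n) fine (sigma (B i)) = 1.
  apply: EFin_inj; rewrite -sumEFin.
  under eq_bigr do rewrite -sB.
  rewrite big_mkord -measure_bigsetU// -(big_mkord xpredT) cB.
  exact: probability_setT.
have integral1 (r : \bar R) : (\int[sigma]__ r = r)%E.
  rewrite (@integral_cst _ _ _ sigma setT measurableT).
  transitivity (r * 1)%E; last by rewrite mule1.
  congr (_ * _)%E; exact: probability_setT.
have mf (chi : G) : measurable_fun [set: borel G]
    (fun phi : borel G => (f (chi * phi)%g)%:E : \bar R).
  apply/measurable_EFinP; apply: (@continuous_borel_measurable _ _
    (fun phi : G => f (chi * phi)%g)) => phi.
  apply: continuous_comp; [exact: mulg_continuousr|exact: cf].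
have mf1 : measurable_fun [set: borel G] (EFin \o f).
  apply/measurable_EFinP; exact: (@continuous_borel_measurable _ _ f cf).
have mfV (phi : G) : measurable_fun [set: borel G]
    (fun chi : borel G => (f (chi^-1 * phi)%g)%:E : \bar R).
  apply/measurable_EFinP; apply: (@continuous_borel_measurable _ _
    (fun chi : G => f (chi^-1 * phi)%g)) => chi.
  apply: (@continuous_comp _ _ _ (fun chi : G => (chi^-1 * phi)%g) f).
    apply: (@continuous_comp _ _ _ (fun chi : G => (chi, phi))
      (fun y : G * G => (y.1^-1 * y.2)%g)); last exact: continuous_mulg_inv.
    by apply: cvg_pair; [exact: cvg_id|exact: cvg_cst].
  exact: cf.
(* sigma is only known to be left invariant, so translates are averaged over
   psi^-1: chi |-> f (chi^-1 * phi) is a left translate of chi |-> f chi^-1.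
   The constant c is compared with the integral of f by integrating the
   partition estimate in phi. *)
pose c := (\int[sigma]_chi (f (chi^-1 * 1)%g)%:E)%E.
have cE (phi : G) : (c = \int[sigma]_chi (f (chi^-1 * phi)%g)%:E)%E.
  rewrite /c -(@haar_integral_translate _ _ _ phi^-1%g)//.
    by apply: eq_integral => chi _; rewrite invgM invgK mulg1.
  by move=> x; rewrite lee_fin.
have cle : (c <= \int[sigma]_phi (f phi)%:E + (e / 2)%:E)%E.
  rewrite -[leLHS]integral1.
  have mfe i : measurable_fun [set: borel G]
      (fun phi : borel G => (f ((psi i)^-1 * phi)%g + e / 2)%:E : \bar R).
    by under eq_fun do rewrite EFinD; exact: emeasurable_funD.
  have fe0 i (phi : G) : (0 <= (f ((psi i)^-1 * phi)%g + e / 2)%:E)%E.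
    by rewrite lee_fin addr_ge0// ltW.
  (* By left invariance each translate has the same integral as [f], and the weights sum to 1. *)
  have -> : (\int[sigma]_phi (f phi)%:E + (e / 2)%:E =
    \int[sigma]_phi \sum_(0 <= i < n)
       (f ((psi i)^-1 * phi)%g + e / 2)%:E * sigma (B i))%E.
    rewrite ge0_integral_sum//; last 2 first.
    - by move=> i; apply: emeasurable_funM.
    - by move=> i phi _; rewrite mule_ge0.
    under eq_bigr => i _.
      under eq_integral do rewrite muleC.
      rewrite ge0_integralZl//.
      under eq_integral do rewrite EFinD.
      rewrite ge0_integralD//; last 2 first.
      - by move=> x _; rewrite lee_fin.
      - by move=> x _; rewrite lee_fin ltW.
      rewrite (haar_integral_translate (psi i)^-1%g (f := EFin \o f) hs)//=.
      rewrite integral1 sB.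
      over.
    rewrite -ge0_sume_distrl; last by move=> i _; rewrite lee_fin fine_ge0.
    by rewrite sumEFin s1 mul1e.
  apply: ge0_le_integral => //.
  - by move=> x _; rewrite integral_ge0// => y _; rewrite lee_fin.
  - by apply: emeasurable_sum => i; apply: emeasurable_funM.
  - move=> phi _ /=; rewrite (cE phi); apply: integral_le_partition => //.
    + by move=> x; rewrite lee_fin.
    + move=> i chi Bchi; rewrite lee_fin -lerBlDl ltW//.
      by rewrite (le_lt_trans (ler_norm _))// fB.
split => // phi.
  by rewrite fine_ge0.
rewrite [in leRHS](splitr e) EFinD addeA.
apply: (@le_trans _ _ (c + (e / 2)%:E)%E); last by rewrite leeD2r.
rewrite (cE phi) -(integral1 (e / 2)%:E).
rewrite -ge0_integralD//; last 2 first.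
- by move=> x _; rewrite lee_fin.
- by move=> x _; rewrite lee_fin ltW.
rewrite -sumEFin; under eq_bigr do rewrite EFinM -sB muleC.
apply: integral_ge_partition => //.
- exact: emeasurable_funD.
- by move=> i; rewrite lee_fin.
- move=> i chi Bchi; rewrite -EFinD lee_fin -lerBlDl ltW//.
  by rewrite (le_lt_trans (ler_norm _))// distrC fB.
Qed.

(** * Continuity of powers, approximation of weights, Young's inequality *)

(** Where [g] is positive, differentiability of the power gives continuity; at a zero of [g] the
    tolerance e^(1/p) for [g] is used directly. *)
Lemma powR_comp_continuous (R : realType) (T : topologicalType) (g : T -> R)
    (p : R) :
  0 < p -> (forall x, 0 <= g x) -> continuous g ->
  continuous (fun x => g x `^ p).
Proof.
move=> p0 g0 cg x; have [gx0|gx0] := eqVneq (g x) 0.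
  rewrite /continuous_at gx0 powR0 ?gt_eqF//; apply/cvgrPdist_lt => e e0.
  have d0 : 0 < e `^ p^-1 by rewrite powR_gt0.
  have := cg x; rewrite /continuous_at gx0 => /cvgrPdist_lt/(_ _ d0).
  apply: filterS => y; rewrite !sub0r !normrN !ger0_norm ?powR_ge0// => gy.
  have -> : e = (e `^ p^-1) `^ p.
    by rewrite -powRrM mulVf ?gt_eqF// powRr1// ltW.
  by apply: gt0_ltr_powR => //; rewrite nnegrE ?powR_ge0.
apply: (@continuous_comp _ _ _ g (fun y => y `^ p)); first exact: cg.
apply: differentiable_continuous; apply/derivable1_diffP.
by apply: derivable_powR; rewrite in_itv/= andbT lt_neqAle eq_sym gx0 g0.
Qed.

(* The weights are approximated by multiplicities over a common denominator. *)
Lemma weighted_bound_of_multiset_bound (R : realType) (X Y : Type)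
    (f : X -> Y -> R) (A D : R) :
  (forall x y, 0 <= f x y) -> 0 <= A ->
  (forall (s : seq X) (M : R), (forall y, \sum_(x <- s) f x y <= M) ->
     (size s)%:R * A <= D * M) ->
  forall (n : nat) (w : nat -> R) (x : nat -> X) (M : R),
    (forall i, 0 <= w i) -> \sum_(0 <= i < n) w i = 1 ->
    (forall y, \sum_(0 <= i < n) w i * f (x i) y <= M) -> A <= D * M.
Proof.
move=> f0 A0 bound n w x M w0 w1 wM.
(* Truncating [N * w i] loses less than one copy of each [x i], so the family has at least [N - n]
   entries, while its sums stay below [N * M]. *)
have step (N : nat) : (N%:R - n%:R) * A <= N%:R * (D * M).
  pose s := flatten
    [seq nseq (Num.trunc (N%:R * w i)) (x i) | i <- index_iota 0 n].
  have Nw0 i : 0 <= N%:R * w i by rewrite mulr_ge0.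
  have szs : N%:R - n%:R <= (size s)%:R :> R.
    rewrite size_flatten sumnE /shape -map_comp big_map natr_sum.
    have -> : n%:R = \sum_(0 <= i < n) 1 :> R by rewrite sumr_const_nat subn0.
    rewrite lerBlDr -big_split/=.
    rewrite (@le_trans _ _ (\sum_(0 <= i < n) N%:R * w i))//.
      by rewrite -mulr_sumr w1 mulr1.
    apply: ler_sum => i _; rewrite size_nseq natr1 ltW//.
    by have /andP[] := truncn_itv (Nw0 i).
  apply: (@le_trans _ _ ((size s)%:R * A)); first by rewrite ler_wpM2r.
  rewrite mulrCA; apply: bound => y.
  rewrite big_flatten big_map.
  apply: (@le_trans _ _ (N%:R * \sum_(0 <= i < n) w i * f (x i) y)); last first.
    by rewrite ler_wpM2l.
  rewrite mulr_sumr; apply: ler_sum => i _.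
  rewrite big_nseq iter_addr addr0 -[leLHS]mulr_natl mulrA ler_wpM2r//.
  by have /andP[] := truncn_itv (Nw0 i).
(* If [D * M < A], any [N] above [n * A / (A - D * M)] contradicts [step]. *)
rewrite leNgt; apply/negP => DA.
have d0 : 0 < A - D * M by rewrite subr_gt0.
have := step (Num.trunc (n%:R * A / (A - D * M))).+1.
set N := (_.+1)%:R : R.
have : n%:R * A / (A - D * M) < N by exact: truncnS_gt.
rewrite ltr_pdivrMr// mulrBr => h1; rewrite mulrBl; lra.
Qed.

(** Young's inequality for s and t^(p-1) with conjugate exponents p and p/(p-1). At p = 1 the second
    exponent is infinite; there t^0 = 1, even for t = 0, and both sides equal s. *)
Lemma young_powR (R : realType) (p s t : R) : 1 <= p -> 0 <= s -> 0 <= t ->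
  t `^ (p - 1) * s <= (1 - p^-1) * t `^ p + p^-1 * s `^ p.
Proof.
move=> p1 s0 t0; have p0 : 0 < p by exact: lt_le_trans p1.
move: p1; rewrite le_eqVlt => /predU1P[<-|p1].
  by rewrite subrr powRr0 invr1 subrr mul0r add0r !mul1r powRr1.
have q0 : 0 < p / (p - 1) by rewrite divr_gt0 ?subr_gt0.
have qV : (p / (p - 1))^-1 = 1 - p^-1.
  by rewrite invf_div mulrBl divff ?gt_eqF// mul1r.
have := conjugate_powR s0 (powR_ge0 t (p - 1)) p0 q0.
rewrite qV subrKC => /(_ erefl).
rewrite -powRrM mulrCA divff ?mulr1; last by rewrite gt_eqF// subr_gt0.
move=> h; rewrite mulrC (le_trans h)// addrC [X in X + _]mulrC.
by rewrite [X in _ + X]mulrC.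
Qed.

(** * Functionals on a subspace of C(G) against point evaluations *)

Section Modulus.
Variables (R : realType) (k : scalar_kind).
Local Notation K := (scalars R k).
Implicit Types z w : K.

Lemma modulus_ge0 z : 0 <= scalarRe `|z|.
Proof. exact: (@rnorm_ge0 R k K^o). Qed.

Lemma modulusM z w : scalarRe `|z * w| = scalarRe `|z| * scalarRe `|w|.
Proof. exact: (@rnormZ R k K^o). Qed.

Lemma modulus_realScalar (x : R) : 0 <= x -> scalarRe `|realScalar k x| = x.
Proof.
move=> x0; rewrite ger0_norm ?realScalarK//.
by rewrite -[leLHS](realScalar0 (R := R)) realScalar_le.
Qed.

Lemma modulus_sum (I : Type) (r : seq I) (F : I -> K) :
  scalarRe `|\sum_(i <- r) F i| <= \sum_(i <- r) scalarRe `|F i|.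
Proof.
elim/big_ind2 : _ => //.
  by rewrite normr0 -[X in scalarRe X](realScalar0 (R := R)) realScalarK.
by move=> ? ? ? ? h1 h2; apply: (le_trans (@rnormD R k K^o _ _)); exact: lerD.
Qed.

Lemma realScalar_sum (I : Type) (r : seq I) (F : I -> R) :
  realScalar k (\sum_(i <- r) F i) = \sum_(i <- r) realScalar k (F i).
Proof.
by apply: (big_morph _ (@realScalarD R k)); exact: realScalar0.
Qed.

Lemma dual_ball_le (E : normedModType K) (alpha : {scalar E}) (x : E) :
  dual_ball alpha -> `|alpha x| <= `|x|.
Proof.
move=> [_ ball_alpha]; have [->|x0] := eqVneq x 0.
  by rewrite linear0 !normr0.
have nx0 : `|x| != 0 by rewrite normr_eq0.
have := ball_alpha (`|x|^-1 *: x).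
rewrite normrZ normfV normr_id mulVf// => /(_ (lexx _)).
by rewrite linearZ /= normrM normfV normr_id ler_pdivrMl ?normr_gt0// mulr1.
Qed.

Lemma subspace_evalD (G : compactGroupType) (H : submodClosed (cspace R k G))
    (v w : subspace_of H) x : val (v + w) x = val v x + val w x.
Proof. by rewrite raddfD. Qed.

Lemma subspace_evalZ (G : compactGroupType) (H : submodClosed (cspace R k G))
    (a : K) (v : subspace_of H) x : val (a *: v) x = a * val v x.
Proof. by rewrite linearZ. Qed.

Lemma subspace_eval_sum (G : compactGroupType) (H : submodClosed (cspace R k G))
   (n : nat) (F : 'I_n -> subspace_of H) x :
   val (\sum_(i < n) F i) x = \sum_(i < n) val (F i) x.
Proof.
have e0 : val (0 : subspace_of H) x = 0.
  by rewrite -(scale0r (0 : subspace_of H)) subspace_evalZ mul0r.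
elim/big_rec2: _ => // i y z _ <-.
exact: subspace_evalD.
Qed.

(** A functional in the dual ball is bounded by the sup norm, so applying it to a suitable
    combination [v] of the [g j] reduces the sum of powers to values at single points, where [M]
    applies. *)
Lemma dual_ball_sum_powR (G : compactGroupType)
    (H : submodClosed (cspace R k G)) (p M : R) (n : nat)
    (g : 'I_n -> subspace_of H) (alpha : {scalar (subspace_of H)}) :
  1 <= p -> dual_ball alpha ->
  (forall phi, \sum_(j < n) scalarRe `|val (g j) phi| `^ p <= M) ->
  \sum_(j < n) scalarRe `|alpha (g j)| `^ p <= M.
Proof.
move=> p1 ball_alpha gM.
have p0 : 0 < p by exact: lt_le_trans p1.
set A := (X in X <= _).
(* The c j realize the l^p norm of (alpha (g j))_j by duality; Young's
   inequality then replaces Hoelder's, with the A-term absorbed on the left. *)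
pose c j := realScalar k (scalarRe `|alpha (g j)| `^ p) / alpha (g j).
have cE j : c j * alpha (g j) = realScalar k (scalarRe `|alpha (g j)| `^ p).
  (* Where [alpha (g j)] vanishes, division by zero gives [c j = 0], and both sides are 0 because
     [p] is positive. *)
  rewrite /c; have [->|z0] := eqVneq (alpha (g j)) 0; last by rewrite divfK.
  rewrite mulr0 normr0 -[X in scalarRe X](realScalar0 (R := R)) realScalarK.
  by rewrite powR0 ?gt_eqF// realScalar0.
have c_le j : scalarRe `|c j| <= scalarRe `|alpha (g j)| `^ (p - 1).
  have [z0|z0] := eqVneq (alpha (g j)) 0.
    rewrite /c z0 invr0 mulr0 normr0 -[X in scalarRe X](realScalar0 (R := R)).
    by rewrite realScalarK powR_ge0.
  have m0 : 0 < scalarRe `|alpha (g j)|.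
    rewrite lt_neqAle modulus_ge0 andbT eq_sym; apply: contra z0 => /eqP.
    by move=> /(@rnorm0_eq0 R k K^o) ->.
  rewrite -(ler_pM2r m0) -modulusM cE modulus_realScalar ?powR_ge0//.
  by rewrite mulrC mulr_powRB1// ltW.
pose v := \sum_(j < n) c j *: g j.
have A0 : 0 <= A by apply: sumr_ge0 => j _; exact: powR_ge0.
have M0 : 0 <= M.
  by apply: le_trans (gM 1%g); apply: sumr_ge0 => j _; exact: powR_ge0.
have Av : A = scalarRe `|alpha v|.
  rewrite /v linear_sum/=; under eq_bigr do rewrite linearZ/= cE.
  by rewrite -realScalar_sum modulus_realScalar.
have vphi phi : val v phi = \sum_(j < n) c j * val (g j) phi.
  by rewrite subspace_eval_sum; apply: eq_bigr => j _; rewrite subspace_evalZ.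
have : A <= (1 - p^-1) * A + p^-1 * M.
  rewrite {1}Av; apply: (le_trans (scalarRe_le (dual_ball_le v ball_alpha))).
  rewrite -[leLHS]/(scalarRe (realScalar k (sup_norm (val v)))) realScalarK.
  apply: sup_norm_le => [|phi].
    by rewrite addr_ge0// mulr_ge0// ?invr_ge0 ?subr_ge0 ?invf_le1// ltW.
  rewrite /rnorm vphi (le_trans (modulus_sum _ _))//.
  rewrite (@le_trans _ _ (\sum_(j < n)
      ((1 - p^-1) * scalarRe `|alpha (g j)| `^ p
      + p^-1 * scalarRe `|val (g j) phi| `^ p)))//.
    apply: ler_sum => j _; rewrite modulusM.
    apply: le_trans (young_powR p1 (modulus_ge0 _) (modulus_ge0 _)).
    by rewrite ler_wpM2r ?modulus_ge0.
  rewrite big_split/= -!mulr_sumr lerD2l ler_wpM2l// invr_ge0 ltW//.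
rewrite mulrBl mul1r -addrA lerDl addrC subr_ge0 ler_pM2l// invr_gt0//.
Qed.

End Modulus.

(** * Products of functionals and families of translates *)

Section Operator.
Variables (R : realType) (k : scalar_kind) (m : nat).
Variables (G : 'I_m -> compactGroupType).
Variable H : forall i, submodClosed (cspace R k (G i)).
Local Notation K := (scalars R k).

(** Functionals give way to evaluations one coordinate at a time: each product is linear in a single
    coordinate, so [dual_ball_sum_powR] applies with the other factors as scalar coefficients. *)
Lemma dual_ball_prod_sum_powR (p M : R) (n : nat)
    (x q : 'I_n -> forall i, subspace_of (H i))
    (alpha : forall i, {scalar (subspace_of (H i))}) :
  1 <= p -> (forall i, dual_ball (alpha i)) ->
  (forall phi : forall i, G i,
     \sum_(j < n) scalarRe `|\prod_(i < m) val (x j i) (phi i)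
                            - \prod_(i < m) val (q j i) (phi i)| `^ p <= M) ->
  \sum_(j < n) scalarRe `|\prod_(i < m) alpha i (x j i)
                         - \prod_(i < m) alpha i (q j i)| `^ p <= M.
Proof.
move=> p1 ball_alpha evM.
pose ev i (phi : G i) : subspace_of (H i) -> K := fun T => val T phi.
(* The coordinates in l carry arbitrary functionals, the others evaluations. *)
suff main (l : seq 'I_m) : forall beta : (forall i, subspace_of (H i) -> K),
    (forall i, (exists phi, beta i = ev i phi) \/
       (i \in l /\ exists2 a : {scalar (subspace_of (H i))},
          dual_ball a & beta i = a)) ->
    \sum_(j < n) scalarRe `|\prod_(i < m) beta i (x j i)
                         - \prod_(i < m) beta i (q j i)| `^ p <= M.
  apply: (main (enum 'I_m) (fun i => alpha i)) => i; right.
  by split; [rewrite mem_enum | exists (alpha i)].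
elim: l => [|i0 l IH] beta beta_good.
  have beta_ev i : exists phi, beta i = ev i phi.
    by case: (beta_good i) => // -[].
  pose phi i := projT1 (cid (beta_ev i)).
  have phiE i : beta i = ev i (phi i) by exact: projT2 (cid (beta_ev i)).
  apply: le_trans (evM phi); apply: ler_sum => j _.
  have prodE (z : forall i, subspace_of (H i)) :
      \prod_(i < m) beta i (z i) = \prod_(i < m) val (z i) (phi i).
    by apply: eq_bigr => i _; rewrite phiE.
  by rewrite !prodE.
have [[phi0 beta0]|[_ [a ball_a beta0]]] := beta_good i0.
  apply: IH => i; have [?|[]] := beta_good i; first by left.
  rewrite inE => /predU1P[->|li] ai; last by right.
  by left; exists phi0.
pose cx j := \prod_(i < m | i != i0) beta i (x j i).
pose cq j := \prod_(i < m | i != i0) beta i (q j i).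
have -> : \sum_(j < n) scalarRe `|\prod_(i < m) beta i (x j i)
                         - \prod_(i < m) beta i (q j i)| `^ p =
  \sum_(j < n) scalarRe `|a (cx j *: x j i0 - cq j *: q j i0)| `^ p.
  have prodE (z : forall i, subspace_of (H i)) : \prod_(i < m) beta i (z i) =
      \prod_(i < m | i != i0) beta i (z i) * a (z i0).
    by rewrite (bigD1 i0)//= beta0 mulrC.
  by apply: eq_bigr => j _; rewrite !prodE linearB !linearZ.
apply: dual_ball_sum_powR => // phi.
(* The pointwise bound at [phi] is the induction hypothesis with evaluation at [phi] in place of
   [beta i0]. *)
have := IH (dfwith beta i0 (ev i0 phi)).
have betaE (z : forall i, subspace_of (H i)) :
    \prod_(i < m) dfwith beta i0 (ev i0 phi) i (z i) =
    \prod_(i < m | i != i0) beta i (z i) * val (z i0) phi.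
  rewrite (bigD1 i0)//= dfwithin mulrC; congr (_ * _).
  by apply: eq_bigr => i ii0; rewrite dfwithout// eq_sym.
under eq_bigr do rewrite !betaE.
under [X in _ -> X <= _]eq_bigr do
  rewrite subspace_evalD -scaleNr !subspace_evalZ mulNr.
apply => i; have [->|ii0] := eqVneq i i0.
  by left; exists phi; rewrite dfwithin.
rewrite dfwithout 1?eq_sym//.
by have [?|[]] := beta_good i; [left | rewrite inE (negbTE ii0)/=; right].
Qed.

Definition prod_dist (T S : forall i, subspace_of (H i))
    (phi : prod_group G) : R :=
  scalarRe `|\prod_(i < m) val (T i) (phi i) - \prod_(i < m) val (S i) (phi i)|.

Lemma prod_dist_continuous (T S : forall i, subspace_of (H i)) :
  continuous (prod_dist T S).
Proof.
have cP (U : forall i, subspace_of (H i)) :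
    continuous
      (fun phi : prod_group G => \prod_(i < m) val (U i) (phi i) : K^o).
  elim: (index_enum 'I_m) => [|i l IH] phi.
    under eq_fun do rewrite big_nil.
    exact: cst_continuous.
  under eq_fun do rewrite big_cons.
  have ci : continuous (fun phi : prod_group G => val (U i) (phi i) : K^o).
    move=> x.
    apply: (@continuous_comp _ _ _ (fun phi : prod_group G => phi i)
      (fun y : G i => val (U i) y : K^o)); last exact: cts_fun.
    exact: (@proj_continuous _ G i).
  by have := @cvgM K _ (nbhs phi) _ _ _ _ _ (ci phi) (IH phi); apply.
move=> phi; apply: (@continuous_comp _ _ _
  (fun phi : prod_group G => \prod_(i < m) val (T i) (phi i)
                     - \prod_(i < m) val (S i) (phi i) : K^o) (@rnorm R k K^o)).
  exact: (@cvgB K K^o _ (nbhs phi) _ _ _ _ _ (cP T phi) (cP S phi)).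
exact: rnorm_continuous.
Qed.

(** A pointwise bound [M] on the product group replaces the supremum over the dual balls. Raising
    both sides to the power p turns the semi-integral constant into its p-th power. *)
Lemma semi_integral_translates
    (H_inv : forall i, translation_invariant (H i))
    (F : normedModType K) (p : R) (u : (forall i, subspace_of (H i)) -> F) :
  1 <= p -> translation_multi_invariant H_inv u ->
  lipschitz_semi_integral p u ->
  exists2 C : R, 0 < C &
  forall (T S : forall i, subspace_of (H i)) (s : seq (prod_group G)) (M : R),
    (forall phi, \sum_(psi <- s) prod_dist T S (psi * phi)%g `^ p <= M) ->
    (size s)%:R * rnorm (u T - u S) `^ p <= C * M.
Proof.
move=> p1 u_inv [_ _ [C C0 uC]].
have p0 : 0 < p by exact: lt_le_trans p1.
exists (C `^ p); first by rewrite powR_gt0.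
move=> T S s M sM.
have M0 : 0 <= M.
  by apply: le_trans (sM 1%g); apply: sumr_ge0 => *; exact: powR_ge0.
pose x (U : forall i, subspace_of (H i)) (j : 'I_(size s)) :
    forall i, subspace_of (H i) :=
  fun i => subspace_translate (H_inv i) (tnth (in_tuple s) j i) (U i).
have := uC (size s) (x T) (x S).
(* By invariance all [size s] terms on the left coincide. *)
under eq_bigr do rewrite /x !u_inv.
rewrite sumr_const card_ord.
set B := rnorm _ `^ p => uB.
have : ((((size s)%:R * B) `^ p^-1)%:E <= (C * M `^ p^-1)%:E)%E.
  rewrite mulr_natl; apply: (le_trans uB); rewrite EFinM lee_pmul2l//.
  apply: ge_ereal_sup => _ [alpha ball_alpha <-]; rewrite lee_fin.
  apply: ge0_ler_powR; rewrite ?nnegrE ?invr_ge0 ?(ltW p0)//.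
    by apply: sumr_ge0 => *; exact: powR_ge0.
  apply: dual_ball_prod_sum_powR => // phi.
  by have := sM phi; rewrite big_tnth.
rewrite lee_fin => /(ge0_ler_powR (ltW p0)).
rewrite !nnegrE powR_ge0 mulr_ge0 ?powR_ge0 ?(ltW C0)// => /(_ isT isT).
have nB0 : 0 <= (size s)%:R * B by rewrite mulr_ge0// powR_ge0.
rewrite [(C * _) `^ p]powRM ?powR_ge0 ?(ltW C0)//.
by rewrite -(powRrM _ _ p) -(powRrM M) mulVf ?gt_eqF// !powRr1.
Qed.

End Operator.

(** * Passage from finite families of translates to the Haar integral *)

Theorem theorem5p2 (R : realType) (k : scalar_kind) (m : nat)
    (G : 'I_m -> compactGroupType)
    (H : forall i : 'I_m, submodClosed (cspace R k (G i)))
    (H_closed : forall i : 'I_m, closed [set T : cspace R k (G i) | T \in H i])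
    (H_inv : forall i : 'I_m, translation_invariant (H i))
    (F : completeNormedModType (scalars R k))
    (p : R) (p_ge1 : 1 <= p)
    (u : (forall i : 'I_m, subspace_of (H i)) -> F)
    (u_inv : translation_multi_invariant H_inv u)
    (u_lip : lipschitz_semi_integral p u)
    (sigma : probability (borel (prod_group G)) R)
    (sigma_haar : normalized_haar sigma) :
  pietsch_measure p u sigma.
Proof.
split; first exact: sigma_haar.1.
have p0 : 0 < p by exact: lt_le_trans p_ge1.
have [C C0 uC] := semi_integral_translates p_ge1 u_inv u_lip.
(* The constant is the p-th root of the one in the estimate [AI] for p-th powers. *)
exists (C `^ p^-1); first by rewrite powR_gt0.
move=> T S.
pose f (phi : prod_group G) : R := prod_dist T S phi `^ p.
have f0 phi : 0 <= f phi by exact: powR_ge0.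
have cf : continuous f.
  apply: powR_comp_continuous => //; first by move=> phi; exact: modulus_ge0.
  exact: prod_dist_continuous.
pose I := (\int[sigma]_phi (f phi)%:E)%E.
rewrite -[X in (_ * X `^ _)%E]/I.
set A := rnorm (u T - u S).
have A0 : 0 <= A by exact: rnorm_ge0.
have I0 : (0 <= I)%E by apply: integral_ge0 => phi _; rewrite lee_fin.
(* An infinite integral makes the right side infinite, as [p^-1] is nonzero and the constant is
   positive. *)
have [Ioo|Ifin] := eqVneq I +oo%E.
  rewrite Ioo poweRyr ?invr_eq0 ?gt_eqF// gt0_muley ?leey//.
  by rewrite lte_fin powR_gt0.
have {Ifin}IE : I = (fine I)%:E.
  by rewrite fineK// ge0_fin_numE// ltey.
have AI : A `^ p <= C * fine I.
  apply/ler_addgt0Pr => e e0.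
  (* The tolerance [e / C] becomes [e] once multiplied by [C]. *)
  have eC0 : 0 < e / C by rewrite divr_gt0.
  have [n [w [psi [w0 w1 wI]]]] := haar_average sigma_haar cf f0 eC0.
  have -> : C * fine I + e = C * (fine I + e / C).
    by rewrite mulrDr mulrCA divff ?gt_eqF// mulr1.
  (* Points and translations both range over the product group; the bound for finite families passes
     to the weights [w]. *)
  apply: (@weighted_bound_of_multiset_bound _ _ _
    (fun psi phi : prod_group G => f (psi * phi)%g) _ _ _ _ _ n w psi) => //.
  - exact: powR_ge0.
  - by move=> s M sM; exact: uC.
  - by move=> phi; have := wI phi; rewrite -/I IE -EFinD lee_fin.
rewrite IE poweR_EFin -EFinM lee_fin.
have I0' : 0 <= fine I by exact: fine_ge0.
rewrite -powRM ?(ltW C0)//.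
have -> : A = (A `^ p) `^ p^-1 by rewrite -powRrM divff ?gt_eqF// powRr1.
apply: ge0_ler_powR; rewrite ?invr_ge0 ?nnegrE ?powR_ge0 ?(ltW p0)//.
by rewrite mulr_ge0// ltW.
Qed.
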